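(* Let $(L|K,v)$ be a purely inertial extension, let $\eta\in\mathcal{O}_L$ be such that its residue $\eta v$ generates $Lv$ over $Kv$ (so $L=K(\eta)$), let $p=\mathrm{char}(Kv)>0$, and let $B$ be the set of exponents attached to the minimal key polynomials for $\Psi_1$ (with respect to the valuation $\nu$ on $K[x]$ defined by $v$ and $\eta$). Then $$\Omega=(0)\iff Lv|Kv\text{ is separable}\iff p\nmid B,$$ where $p\nmid B$ means that not every element of $B$ is divisible by $p$.
   Context: $\mathcal{O}_L,\mathcal{O}_K$ are the valuation rings, $Lv,Kv$ the residue fields, $\Omega$ the $\mathcal{O}_L$-module of Kähler differentials of $\mathcal{O}_L|\mathcal{O}_K$. A simple algebraic extension of valued fields $(L|K,v)$ is purely inertial if $Lv|Kv$ is simple and $[L:K]=[Lv:Kv]$. Let $\nu(f)=v(f(\eta))$ on $K[x]$, and fix an extension of $\nu$ to $\overline K[x]$. For $f\in K[x]\setminus K$, $\delta(f)=\max\{\nu(x-a)\mid f(a)=0\}$. A monic $Q\in K[x]\setminus K$ is a key polynomial for $\nu$ if $\delta(f)\ge\delta(Q)\Rightarrow\deg f\ge\deg Q$ for all $f\in K[x]\setminus K$. $\Psi_m$ is the set of key polynomials of degree $m$; for a pure extension of degree $n$ it is non-empty only for $m=1$ and $m=n$. A key polynomial for $\Psi_1$ is a key polynomial for $\nu$ whose degree is the smallest degree, among key polynomials, strictly larger than $1$. Here $\nu(\Psi_1)$ has a maximum, namely $0=v\eta$; let $\mathbf{Q}_1=\{Q\}$ with $Q\in\Psi_1$ of maximal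 value (e.g. $Q=x$). Write the $Q$-expansion of $F$ as $F=F_{r,Q}Q^r+\ldots+F_{0,Q}$ ($\deg F_{\ell,Q}<\deg Q$). A key polynomial $F$ for $\Psi_1$ is minimal if there is a subset $B\subseteq\mathbb{N}$ ($\mathbb N$ = positive integers) such that $F_{0,Q}+\sum_{\ell\in B}F_{\ell,Q}Q^\ell$ is a key polynomial for $\Psi_1$ but for every $s\in B$ the polynomial $F_{0,Q}+\sum_{\ell\in B\setminus\{s\}}F_{\ell,Q}Q^\ell$ is not a key polynomial for $\Psi_1$. The paper states that $B$ does not depend on $F$ or $Q$. *)

(* Defs.v *)
From HB Require Import structures.
From mathcomp Require Import all_boot all_order all_algebra falgebra fieldext separable.
From mathcomp Require Import generic_quotient ring_quotient.
From mathcomp Require Import boolp classical_sets.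

Set Implicit Arguments.
Unset Strict Implicit.
Unset Printing Implicit Defensive.

Import Order.TTheory GRing.Theory.

Local Open Scope ring_scope.
Local Open Scope quotient_scope.

(* [porderZmodType] relates neither its order to its sum nor the elements to one
   another.  Totality is a field here rather than a [Order.Total] parent, a join
   that would lie above the library's [Num.RealDomain]. *)
HB.mixin Record isOrderedAbGroup G of Num.POrderedZmodule G := {
  oag_le_total : total (<=%R : rel G);
  oag_leD2l : forall x y z : G, x <= y -> z + x <= z + y
}.

#[short(type="orderedAbGroupType")]
HB.structure Definition OrderedAbGroup :=
  {G of Num.POrderedZmodule G & isOrderedAbGroup G}.

Section ExtendedGroup.
Variable G : orderedAbGroupType.

Definition vext : Type := option G.
Definition vfin (g : G) : vext := Some g.
Definition vinfty : vext := None.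

HB.instance Definition _ := Choice.on vext.

Definition vle (x y : vext) : bool :=
  match x, y with
  | _, None => true
  | None, Some _ => false
  | Some a, Some b => a <= b
  end.

Definition vlt (x y : vext) : bool := (y != x) && vle x y.

Fact vle_anti : antisymmetric vle.
Proof. by case=> [a|] [b|] //= /le_anti ->. Qed.

Fact vle_trans : transitive vle.
Proof. by move=> [b|] [a|] [c|] //=; apply: le_trans. Qed.

Fact vle_total : total vle.
Proof. by move=> [a|] [b|] //=; apply: oag_le_total. Qed.

HB.instance Definition _ := @Order.isOrder.Build ring_display vext vle vlt
  (fun x y => if vlt x y then x else y) (fun x y => if vlt x y then y else x)
  (fun _ _ => erefl) (fun _ _ => erefl) (fun _ _ => erefl)
  vle_anti vle_trans vle_total.

Definition vadd (x y : vext) : vext :=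
  match x, y with
  | Some a, Some b => Some (a + b)
  | _, _ => None
  end.

End ExtendedGroup.

Arguments vinfty {G}.

(* Nonzero elements may have infinite value, as for f |-> v (f.[eta]) on {poly K};
   over a field [valM] and [val1] exclude it. *)
Record valuation (R : comNzRingType) (G : orderedAbGroupType) := Valuation {
  val_fun :> R -> vext G;
  val0 : val_fun 0 = vinfty;
  val1 : val_fun 1 = vfin 0;
  valM : forall x y, val_fun (x * y) = vadd (val_fun x) (val_fun y);
  valD : forall x y, Order.min (val_fun x) (val_fun y) <= val_fun (x + y)
}.

Section Comap.
Variables (A B : comNzRingType) (G : orderedAbGroupType).
Variables (f : {rmorphism A -> B}) (v : valuation B G).

Program Definition valcomp : valuation A G :=
  @Valuation A G (fun x => v (f x)) _ _ _ _.
Next Obligation. by rewrite rmorph0 val0. Qed.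
Next Obligation. by rewrite rmorph1 val1. Qed.
Next Obligation. by rewrite rmorphM valM. Qed.
Next Obligation. by rewrite rmorphD valD. Qed.

End Comap.

Section ValuationTheory.
Variables (R : comNzRingType) (G : orderedAbGroupType) (v : valuation R G).

Lemma vadd0 (x : vext G) : vadd (vfin 0) x = x.
Proof. by case: x => //= a; rewrite add0r. Qed.

Lemma vadd_ge0 (x y : vext G) : vfin 0 <= x -> vfin 0 <= y -> vfin 0 <= vadd x y.
Proof.
case: x y => [a|] [b|] //; rewrite /Order.le /= => a0 b0.
by apply: le_trans a0 _; rewrite -{1}[a]addr0; apply: oag_leD2l.
Qed.

Lemma vadd_gt0 (x y : vext G) : vfin 0 <= x -> vfin 0 < y -> vfin 0 < vadd x y.
Proof.
case: x y => [a|] [b|] // a0 b0; rewrite lt_neqAle vadd_ge0 ?(ltW b0) ?andbT //.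
apply/eqP => -[ab0]; move: b0; rewrite lt_neqAle => /andP[/eqP nb b0]; apply: nb.
suff b0' : b <= 0 by congr Some; apply/le_anti/andP.
rewrite ab0 -{1}[b]add0r addrC [a + b]addrC.
exact: oag_leD2l.
Qed.

Lemma valN1 : v (-1) = vfin 0.
Proof.
have : vadd (v (-1)) (v (-1)) = vfin 0 by rewrite -valM mulrNN mulr1 val1.
case: (v (-1)) => //= a [aa0]; congr Some; apply/eqP; rewrite eq_le.
by case/orP: (oag_le_total a 0) => a0;
   rewrite a0 ?andbT /=; have := oag_leD2l _ _ a a0; rewrite aa0 addr0.
Qed.

Lemma valN x : v (- x) = v x.
Proof. by rewrite -mulN1r valM valN1 vadd0. Qed.

Lemma valD_ge c x y : c <= v x -> c <= v y -> c <= v (x + y).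
Proof. by move=> cx cy; apply: le_trans (valD v x y); rewrite le_min cx cy. Qed.

Lemma valD_gt c x y : c < v x -> c < v y -> c < v (x + y).
Proof. by move=> cx cy; apply: lt_le_trans (valD v x y); rewrite lt_min cx cy. Qed.

End ValuationTheory.

Section FieldValuation.
Variables (F : fieldType) (G : orderedAbGroupType) (v : valuation F G).

Lemma val_fin (x : F) : x != 0 -> exists a, v x = vfin a.
Proof.
move=> x0; case E: (v x) => [a|]; first by exists a.
by have := val1 v; rewrite -(mulfV x0) valM E.
Qed.

Lemma valV (x : F) a : x != 0 -> v x = vfin a -> v x^-1 = vfin (- a).
Proof.
move=> x0 E; have := val1 v; rewrite -(mulVf x0) valM E.
case: (v x^-1) => //= b [ba0]; congr Some.
by rewrite -[b](addrK a) ba0 sub0r.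
Qed.

Lemma val_div (x y : F) : y != 0 -> v y <= v x -> vfin 0 <= v (x / y).
Proof.
move=> y0; have [a Ea] := val_fin y0; rewrite valM Ea (valV y0 Ea).
case: (v x) => //= b; rewrite /Order.le /= => ab.
by rewrite -(addNr a) [b - a]addrC; apply: oag_leD2l.
Qed.

Definition valpred : {pred F} := fun x => vfin 0 <= v x.

Fact valpred_subring : subring_closed valpred.
Proof.
split=> [|x y|x y]; rewrite !unfold_in ?val1 //.
  by move=> x0 y0; apply: valD_ge; rewrite ?valN.
by move=> x0 y0; rewrite valM vadd_ge0.
Qed.
HB.instance Definition _ := GRing.isSubringClosed.Build F valpred valpred_subring.

Record valring := ValRing { vrval :> F; vrvalP : vrval \in valpred }.
HB.instance Definition _ := [isSub for vrval].
HB.instance Definition _ := [Choice of valring by <:].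
HB.instance Definition _ := [SubChoice_isSubComNzRing of valring by <:].

Definition maxideal : {pred valring} := fun x => vfin 0 < v (val x).

Fact maxideal_idealr : idealr_closed maxideal.
Proof.
split=> [||a x y]; rewrite !unfold_in.
- by rewrite rmorph0 val0.
- by rewrite rmorph1 val1 ltxx.
- move=> x0 y0; rewrite rmorphD rmorphM; apply: valD_gt => //.
  by rewrite valM; apply: vadd_gt0 => //; apply: vrvalP.
Qed.
HB.instance Definition _ := isIdealr.Build valring maxideal maxideal_idealr.

Definition resfield : Type := {ideal_quot maxideal}.
HB.instance Definition _ := GRing.ComNzRing.on resfield.

Definition res : valring -> resfield := \pi_({ideal_quot maxideal}).
HB.instance Definition _ := GRing.RMorphism.on res.

Definition resrepr (y : resfield) : valring := repr y.

Lemma resreprK y : res (resrepr y) = y.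
Proof. exact: reprK. Qed.

Lemma res_surj (y : resfield) : exists x, res x = y.
Proof. by exists (resrepr y); rewrite resreprK. Qed.

Lemma res_eq0 x : (res x == 0) = (vfin 0 < v (val x)).
Proof.
by rewrite /res -(rmorph0 res) /res eqquotE Quotient.equivE subr0.
Qed.

Lemma unit_inv_subproof (x : valring) : res x != 0 -> (val x)^-1 \in valpred.
Proof.
rewrite res_eq0 -leNgt => x0; rewrite /valpred /in_mem /=.
have xn0 : val x != 0 by apply: contraTneq x0 => ->; rewrite val0.
by rewrite -[_^-1]mul1r; apply: val_div => //; rewrite val1.
Qed.

Definition resinv (y : resfield) : resfield :=
  if y == 0 then 0 else res (insubd 0 (val (resrepr y))^-1).

Fact resinvl (y : resfield) : y != 0 -> resinv y * y = 1.
Proof.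
move=> y0; rewrite /resinv (negPf y0).
have Ey : res (repr y) = y by rewrite resreprK.
rewrite -{2}[y]resreprK -rmorphM -(rmorph1 res); congr (res _).
apply: val_inj; rewrite rmorphM rmorph1 /= insubdK; last first.
  by apply: unit_inv_subproof; rewrite resreprK.
rewrite mulVf //; apply: contraNneq y0 => x0.
by have := res_eq0 (resrepr y); rewrite resreprK => ->; rewrite /= x0 val0.
Qed.

Fact resinv0 : resinv 0 = 0.
Proof. by rewrite /resinv eqxx. Qed.

HB.instance Definition _ := GRing.ComNzRing_isField.Build resfield resinvl resinv0.

End FieldValuation.

Arguments valring {F G} v.
Arguments maxideal {F G} v.
Arguments resfield {F G} v.
Arguments res {F G} v x.

Section Extension.
Variables (K : fieldType) (L : fieldExtType K) (G : orderedAbGroupType).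
Variable v : valuation L G.

Definition valbase : valuation K G := valcomp (in_alg L) v.

Fact vincl_subproof (a : valring valbase) : (val a)%:A \in valpred v.
Proof. exact: vrvalP a. Qed.

Definition vincl (a : valring valbase) : valring v := ValRing (vincl_subproof a).

Fact vincl_zmod_morphism : zmod_morphism vincl.
Proof. by move=> a b; apply: val_inj; exact: scalerBl. Qed.
Fact vincl_monoid_morphism : monoid_morphism vincl.
Proof.
split=> [|a b]; apply: val_inj; first exact: scale1r.
exact: (rmorphM (in_alg L)).
Qed.
HB.instance Definition _ :=
  GRing.isZmodMorphism.Build (valring valbase) (valring v) vincl
    vincl_zmod_morphism.
HB.instance Definition _ :=
  GRing.isMonoidMorphism.Build (valring valbase) (valring v) vincl
    vincl_monoid_morphism.

Lemma res_vincl_eq0 a : (res v (vincl a) == 0) = (res valbase a == 0).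
Proof. by rewrite !res_eq0. Qed.

Definition resincl (y : resfield valbase) : resfield v := res v (vincl (resrepr y)).

Lemma resinclE a : resincl (res valbase a) = res v (vincl a).
Proof.
apply/eqP; rewrite /resincl -subr_eq0 -!rmorphB res_vincl_eq0 rmorphB subr_eq0.
by rewrite /= resreprK.
Qed.

Fact resincl_zmod_morphism : zmod_morphism resincl.
Proof.
move=> x y; have [[a <-] [b <-]] := (res_surj x, res_surj y).
by rewrite -rmorphB !resinclE !rmorphB.
Qed.
Fact resincl_monoid_morphism : monoid_morphism resincl.
Proof.
split=> [|x y]; first by rewrite -(rmorph1 (res valbase)) resinclE !rmorph1.
have [[a <-] [b <-]] := (res_surj x, res_surj y).
by rewrite -rmorphM !resinclE !rmorphM.
Qed.
HB.instance Definition _ :=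
  GRing.isZmodMorphism.Build (resfield valbase) (resfield v) resincl
    resincl_zmod_morphism.
HB.instance Definition _ :=
  GRing.isMonoidMorphism.Build (resfield valbase) (resfield v) resincl
    resincl_monoid_morphism.

(* An alias carrying the structure of a finite extension of the residue field
   of K. *)
Definition resext : Type := resfield v.
HB.instance Definition _ := GRing.Field.on resext.

Definition resscale (a : resfield valbase) (x : resext) : resext := resincl a * x.

Fact resscaleA a b x : resscale a (resscale b x) = resscale (a * b) x.
Proof. by rewrite /resscale rmorphM mulrA. Qed.
Fact resscale1 : left_id 1 resscale.
Proof. by move=> x; rewrite /resscale rmorph1 mul1r. Qed.
Fact resscaleDr : right_distributive resscale +%R.
Proof. by move=> a x y; rewrite /resscale mulrDr. Qed.
Fact resscaleDl x : {morph resscale^~ x : a b / a + b}.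
Proof. by move=> a b; rewrite /resscale rmorphD mulrDl. Qed.
HB.instance Definition _ := GRing.Zmodule_isLmodule.Build (resfield valbase) resext
  resscaleA resscale1 resscaleDr resscaleDl.
Fact resscaleAl (a : resfield valbase) (x y : resext) : a *: (x * y) = a *: x * y.
Proof. exact: mulrA. Qed.
HB.instance Definition _ :=
  GRing.Lmodule_isLalgebra.Build (resfield valbase) resext resscaleAl.
HB.instance Definition _ :=
  GRing.Lalgebra_isComAlgebra.Build (resfield valbase) resext.

Definition rescomb m (b : 'I_m -> resext) (u : 'rV[resfield valbase]_m) : resext :=
  \sum_i u 0 i *: b i.

Definition resfree m (b : 'I_m -> resext) : Prop :=
  forall u, rescomb b u = 0 -> u = 0.

Fact rescomb_linear m (b : 'I_m -> resext) : linear (rescomb b).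
Proof.
move=> a u w; rewrite /rescomb scaler_sumr -big_split /=.
by apply: eq_bigr => i _; rewrite !mxE scalerDl scalerA.
Qed.
HB.instance Definition _ m b :=
  GRing.isLinear.Build (resfield valbase) 'rV_m resext *:%R (rescomb b)
    (@rescomb_linear m b).

(* Lifts of linearly independent residues are linearly independent. *)
Lemma resfree_dim m (b : 'I_m -> resext) : resfree b -> (m <= \dim {:L})%N.
Proof.
move=> bfree; pose x := [tuple val (resrepr (b i)) | i < m].
suff /eqnP xfree : free x.
  by rewrite -{1}(size_tuple x) -xfree; apply/dimvS/subvf.
apply/freeP => k sum0 j; apply/eqP/contraT => kj0.
pose i0 := [arg min_(i < j) valbase (k i)]%O.
have i0P i : valbase (k i0) <= valbase (k i).
  by rewrite /i0; case: arg_minP => // l _; apply.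
have ki0 : k i0 != 0.
  have [c Ec] := val_fin valbase kj0.
  by apply/eqP => E; have := i0P j; rewrite E val0 Ec.
pose a i : valring valbase := ValRing (val_div ki0 (i0P i)).
have : rescomb b (\row_i res _ (a i)) = 0.
  transitivity (res v (\sum_i vincl (a i) * resrepr (b i))).
    rewrite rmorph_sum; apply: eq_bigr => i _; rewrite mxE rmorphM /=.
    by rewrite resreprK -resinclE.
  suff -> : \sum_i vincl (a i) * resrepr (b i) = 0 by rewrite rmorph0.
  apply: val_inj; rewrite rmorph_sum rmorph0 /=.
  transitivity ((k i0)^-1 *: \sum_i k i *: x`_i); last by rewrite sum0 scaler0.
  rewrite scaler_sumr; apply: eq_bigr => i _.
  rewrite -tnth_nth tnth_mktuple scalerA [_^-1 * _]mulrC.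
  exact: (mulr_algl (k i / k i0) (val (resrepr (b i)))).
move/bfree/rowP/(_ i0); rewrite !mxE => /eqP; rewrite res_eq0 /= mulfV //.
by rewrite scale1r val1 ltxx.
Qed.

Lemma resbasis_ex : exists m, exists b : 'I_m -> resext,
  resfree b /\ forall y, exists u, rescomb b u = y.
Proof.
pose P m := `[< exists b : 'I_m -> resext, resfree b >].
have P0 : exists m, P m.
  exists 0%N; apply/asboolP; exists (fun=> 0) => u _.
  by apply/rowP; case.
have Pb m : P m -> (m <= \dim {:L})%N by case/asboolP => b /resfree_dim.
case: (ex_maxnP P0 Pb) => m /asboolP[b bfree] maxm; exists m, b; split=> // y.
apply: contrapT => ny; suff /maxm : P m.+1 by rewrite ltnn.
apply/asboolP; exists (fun i => oapp b y (unlift ord0 i)) => u.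
rewrite /rescomb big_ord_recl unlift_none /=.
under eq_bigr do rewrite liftK /=.
pose w := \row_i u 0 (lift ord0 i).
have -> : \sum_(i < m) u 0 (lift ord0 i) *: b i = rescomb b w.
  by apply: eq_bigr => i _; rewrite mxE.
have [u0|u0] := eqVneq (u 0 0) 0.
  rewrite u0 scale0r add0r => /bfree w0; apply/rowP => i; rewrite mxE.
  case: (unliftP ord0 i) => [j ->|-> //].
  by move/rowP/(_ j): w0; rewrite !mxE.
move=> /eqP; rewrite addr_eq0 => /eqP E; case: ny.
exists (- (u 0 0)^-1 *: w); rewrite linearZ /= scaleNr -scalerN -E scalerA.
by rewrite mulVf // scale1r.
Qed.

Definition resdim : nat := projT1 (cid resbasis_ex).

Fact resext_vect_iso : Vector.axiom resdim resext.
Proof.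
rewrite /resdim; case: cid => m /= /cid[b [bfree bspan]].
pose f y := projT1 (cid (bspan y)).
have fK : cancel f (rescomb b) by move=> y; rewrite /f; case: cid.
have inj : injective (rescomb b).
  move=> u w E; apply/eqP; rewrite -subr_eq0; apply/eqP/bfree.
  by rewrite linearB /= E subrr.
have Kf : cancel (rescomb b) f by move=> u; apply: inj; rewrite fK.
exists f; last by exists (rescomb b).
by move=> a x y; apply: inj; rewrite linearP /= !fK.
Qed.
HB.instance Definition _ :=
  Lmodule_hasFinDim.Build (resfield valbase) resext resext_vect_iso.

HB.instance Definition _ :=
  Algebra_isFalgebra.Build (resfield valbase) resext.

End Extension.

Arguments valbase {K L G} v.
Arguments vincl {K L G} v a.
Arguments resext {K L G} v.

Definition simple_ext (K : fieldType) (L : fieldExtType K) : Prop :=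
  exists x : L, <<1; x>>%VS = {:L}%VS.

Definition purely_inertial (K : fieldType) (L : fieldExtType K)
    (G : orderedAbGroupType) (v : valuation L G) : Prop :=
  [/\ simple_ext L, simple_ext (resext v) & \dim {:L} = \dim {:resext v}].

Definition is_alg_closure (K : fieldType) (Kbar : closedFieldType)
    (iota : {rmorphism K -> Kbar}) : Prop :=
  forall a : Kbar, algebraicOver iota a.

Section KeyPolynomials.
Variables (K : fieldType) (G G' : orderedAbGroupType).
Variables (Kbar : closedFieldType) (iota : {rmorphism K -> Kbar}).
Variable nu : valuation {poly K} G.
Variable nubar : valuation {poly Kbar} G'.
Implicit Types f Q F : {poly K}.

Definition kroots f : seq Kbar := sval (closed_field_poly_normal (map_poly iota f)).

Lemma mem_kroots f a : f != 0 -> (a \in kroots f) = root (map_poly iota f) a.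
Proof.
rewrite /kroots -(map_poly_eq0 iota) -lead_coef_eq0; case: closed_field_poly_normal.
by move=> r /= Er f0; rewrite [in RHS]Er rootZ // root_prod_XsubC.
Qed.

(* Meaningful for nonconstant f only, whose list of roots is not empty: the
   head of the list is then a harmless neutral element. *)
Definition delta f : vext G' :=
  let s := [seq nubar ('X - a%:P) | a <- kroots f] in
  \big[Order.max/head vinfty s]_(d <- s) d.

Definition key_poly Q : Prop :=
  [/\ Q \is monic, (1 < size Q)%N &
      forall f, (1 < size f)%N -> delta Q <= delta f -> (size Q <= size f)%N].

Definition Psi (m : nat) Q : Prop := key_poly Q /\ size Q = m.+1.

Definition key_poly_Psi1 F : Prop :=
  [/\ key_poly F, (2 < size F)%N &
      forall F', key_poly F' -> (2 < size F')%N -> (size F <= size F')%N].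

Definition max_in_Psi1 Q : Prop :=
  Psi 1 Q /\ forall Q', Psi 1 Q' -> nu Q' <= nu Q.

(* The coefficient of Q^l in the Q-expansion of F, for Q monic and nonconstant;
   it vanishes for l > deg F. *)
Definition Qcoef Q F (l : nat) : {poly K} := (F %/ Q ^+ l) %% Q.

Lemma QcoefE Q F : Q \is monic -> (1 < size Q)%N ->
  F = \sum_(l < size F) Qcoef Q F l * Q ^+ l.
Proof.
move=> Qm Q1; have Q0 : Q != 0 by rewrite monic_neq0.
have E n : F = (F %/ Q ^+ n) * Q ^+ n + \sum_(l < n) Qcoef Q F l * Q ^+ l.
  elim: n => [|n IHn]; first by rewrite big_ord0 expr0 divp1 mulr1 addr0.
  rewrite {1}IHn big_ord_recr /= [X in _ = _ + X]addrC addrA; congr (_ + _).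
  by rewrite exprSr -divp_divl [_ ^+ n * Q]mulrC mulrA -mulrDl -divp_eq.
rewrite {1}(E (size F)) divp_small ?mul0r ?add0r //.
have := size_exp Q (size F); case: (size (Q ^+ _)) (size_poly_eq0 (Q ^+ size F)).
  by rewrite eqxx expf_eq0 (negPf Q0) andbF.
by move=> n _ /= ->; rewrite ltnS leq_pmull // -ltnS prednK // ltnW.
Qed.

Definition subexpansion Q F (B : set nat) : {poly K} :=
  Qcoef Q F 0 + \sum_(1 <= l < size F | l \in B) Qcoef Q F l * Q ^+ l.

(* F is a minimal key polynomial for Psi_1, as witnessed by B with respect to Q.
   No independence of B from Q is built in: B may change with Q. *)
Definition minimal_exponents Q F (B : set nat) : Prop :=
  [/\ max_in_Psi1 Q, key_poly_Psi1 F, forall l, B l -> (0 < l)%N,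
      key_poly_Psi1 (subexpansion Q F B) &
      forall s, B s -> ~ key_poly_Psi1 (subexpansion Q F (B `\ s)%classic)].

End KeyPolynomials.

(* Imported late: it shadows [lift] of fintype. *)
From mathcomp.multinomials Require Import freeg.

Section Kahler.
Variables (A B : comNzRingType) (f : {rmorphism A -> B}).

(* The free B-module on the symbols db, b in B. *)
Local Notation M := {freeg B / B}.

Inductive kahler_rel : M -> Prop :=
| KahlerAdd x y : kahler_rel (<< x + y >> - << x >> - << y >>)
| KahlerMul x y : kahler_rel (<< x * y >> - (x *: << y >> + y *: << x >>))
| KahlerBase a : kahler_rel << f a >>.

Definition kahler_span : {pred M} := fun w =>
  `[< exists n (c : 'I_n -> B) (r : 'I_n -> M),
        (forall i, kahler_rel (r i)) /\ w = \sum_i c i *: r i >].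

Fact kahler_span_submod : submod_closed kahler_span.
Proof.
split.
  by apply/asboolP; exists 0%N, (fun=> 0), (fun=> 0); split=> [[]|]; rewrite ?big_ord0.
move=> a u w /asboolP[n [c [r [rP ->]]]] /asboolP[m [d [s [sP ->]]]]; apply/asboolP.
exists (n + m)%N, (fun i => match split i with inl j => a * c j | inr j => d j end).
exists (fun i => match split i with inl j => r j | inr j => s j end); split=> [i|].
  by case: split.
rewrite big_split_ord scaler_sumr; congr (_ + _); apply: eq_bigr => i _.
  by rewrite (unsplitK (inl _ i)) scalerA.
by rewrite (unsplitK (inr _ i)).
Qed.
HB.instance Definition _ :=
  GRing.isSubmodClosed.Build B M kahler_span kahler_span_submod.

Definition kahler : Type := Quotient.quot kahler_span.
HB.instance Definition _ := GRing.Zmodule.on kahler.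

Definition kahler_pi : M -> kahler := \pi_(Quotient.quot kahler_span).
HB.instance Definition _ := GRing.Additive.on kahler_pi.

Definition kahler_scale (b : B) (w : kahler) : kahler := kahler_pi (b *: repr w).

Lemma kahler_pi_eq0 w : (kahler_pi w == 0) = (w \in kahler_span).
Proof.
by rewrite /kahler_pi -(raddf0 kahler_pi) /kahler_pi eqquotE Quotient.equivE subr0.
Qed.

Definition kahler_repr (w : kahler) : M := repr w.

Lemma kahler_reprK w : kahler_pi (kahler_repr w) = w.
Proof. exact: reprK. Qed.

Lemma kahler_scaleE b w : kahler_scale b (kahler_pi w) = kahler_pi (b *: w).
Proof.
apply/eqP; rewrite -subr_eq0 /kahler_scale -raddfB /= kahler_pi_eq0 -scalerBr.
apply: rpredZ; rewrite -kahler_pi_eq0 raddfB /= subr_eq0.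
by rewrite [kahler_pi _]kahler_reprK.
Qed.

Fact kahler_scaleA a b w :
  kahler_scale a (kahler_scale b w) = kahler_scale (a * b) w.
Proof. by rewrite -[w]kahler_reprK !kahler_scaleE scalerA. Qed.
Fact kahler_scale0 w : kahler_scale 0 w = 0.
Proof. by rewrite -[w]kahler_reprK kahler_scaleE scale0r raddf0. Qed.
Fact kahler_scale1 : left_id 1 kahler_scale.
Proof. by move=> w; rewrite -[w]kahler_reprK kahler_scaleE scale1r. Qed.
Fact kahler_scaleDr : right_distributive kahler_scale +%R.
Proof.
move=> a u w; rewrite -[u]kahler_reprK -[w]kahler_reprK -raddfD !kahler_scaleE.
by rewrite scalerDr raddfD.
Qed.
Fact kahler_scaleDl w : {morph kahler_scale^~ w : a b / a + b}.
Proof.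
by move=> a b; rewrite -[w]kahler_reprK !kahler_scaleE scalerDl raddfD.
Qed.
HB.instance Definition _ := GRing.Nmodule_isLSemiModule.Build B kahler
  kahler_scaleA kahler_scale0 kahler_scale1 kahler_scaleDr kahler_scaleDl.

Lemma kahler_piZ b w : kahler_pi (b *: w) = b *: kahler_pi w.
Proof. by rewrite -kahler_scaleE. Qed.

Definition kahler_d (b : B) : kahler := kahler_pi << b >>.

Definition is_derivation (N : lmodType B) (D : B -> N) : Prop :=
  [/\ {morph D : x y / x + y},
      forall x y, D (x * y) = x *: D y + y *: D x & forall a, D (f a) = 0].

Lemma kahler_rel_pi r : kahler_rel r -> kahler_pi r = 0.
Proof.
move=> rP; apply/eqP; rewrite kahler_pi_eq0; apply/asboolP.
by exists 1%N, (fun=> 1), (fun=> r); rewrite big_ord1 scale1r.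
Qed.

Lemma kahler_d_derivation : is_derivation kahler_d.
Proof.
split=> [x y|x y|a]; last exact/kahler_rel_pi/KahlerBase.
  have := kahler_rel_pi (KahlerAdd x y).
  rewrite !raddfB /= => /eqP; rewrite subr_eq add0r subr_eq => /eqP E.
  by rewrite [RHS]addrC.
have := kahler_rel_pi (KahlerMul x y).
by rewrite raddfB raddfD /= !kahler_piZ => /subr0_eq.
Qed.

Lemma fglift_scale (N : lmodType B) (D : B -> N) b w :
  fglift D (b *: w) = b *: fglift D w.
Proof.
pose g : {additive M -> N} :=
  HB.pack (fglift D) (GRing.isZmodMorphism.Build M N _ (lift_is_additive D)).
have gsum (F : B -> M) :
    fglift D (\sum_(x <- dom w) F x) = \sum_(x <- dom w) fglift D (F x).
  exact: (raddf_sum g).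
rewrite -{2}[w]freeg_sumE (gsum (fun x => << coeff x w *g x >>)) scaler_sumr.
rewrite [LHS](gsum (fun x => << b * coeff x w *g x >>)); apply: eq_bigr => x _.
by rewrite !liftU scalerA.
Qed.

Lemma kahler_univ (N : lmodType B) (D : B -> N) : is_derivation D ->
  exists h : {linear kahler -> N}, forall b, h (kahler_d b) = D b.
Proof.
case=> DD DM D0.
have [g gU] : exists g : {linear M -> N}, forall b, g << b >> = D b.
  pose g : {linear M -> N} :=
    HB.pack (fglift D) (GRing.isZmodMorphism.Build M N _ (lift_is_additive D))
      (GRing.isScalable.Build B M N _ (fglift D) (@fglift_scale N D)).
  by exists g => b; rewrite /= liftU scale1r.
have gspan w : w \in kahler_span -> g w = 0.
  case/asboolP => n [c [r [rP ->]]]; rewrite linear_sum big1 // => i _.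
  rewrite linearZ /=; suff -> : g (r i) = 0 by rewrite scaler0.
  case: (rP i) => [x y|x y|a]; last by rewrite gU.
    by rewrite !linearB !gU DD [D x + _]addrC addrK subrr.
  by rewrite linearB linearD !linearZ !gU DM subrr.
have gpi w : g (kahler_repr (kahler_pi w)) = g w.
  apply/eqP; rewrite -subr_eq0 -linearB; apply/eqP/gspan.
  by rewrite -kahler_pi_eq0 raddfB /= kahler_reprK subrr.
have hlin : linear (fun w => g (kahler_repr w)).
  move=> b u w; rewrite -linearP -[in RHS]gpi; congr (g (kahler_repr _)).
  by rewrite raddfD /= kahler_piZ !kahler_reprK.
pose h : {linear kahler -> N} := HB.pack (fun w => g (kahler_repr w))
  (GRing.isLinear.Build B kahler N _ _ hlin).
by exists h => b; rewrite /= gpi gU.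
Qed.

Lemma kahler_gen (w : kahler) :
  exists n (c x : 'I_n -> B), w = \sum_i c i *: kahler_d (x i).
Proof.
pose r := kahler_repr w; exists (size (dom r)).
exists (fun i => coeff (tnth (in_tuple (dom r)) i) r), (tnth (in_tuple (dom r))).
rewrite -[LHS]kahler_reprK -[X in kahler_pi X]freeg_sumE raddf_sum big_tnth /=.
apply: eq_bigr => i _; rewrite -kahler_piZ; congr kahler_pi.
by apply/eqP/freeg_eqP => y; rewrite coeffZ !coeffU mul1r.
Qed.

End Kahler.

Arguments kahler {A B} f.

(* Main.v *)
Require Import Defs.
From HB Require Import structures.
From mathcomp Require Import all_boot all_order all_algebra.
From mathcomp Require Import falgebra fieldext separable.
From mathcomp Require Import boolp classical_sets.

Set Implicit Arguments.
Unset Strict Implicit.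
Unset Printing Implicit Defensive.

Import Order.TTheory GRing.Theory.
Import Defs.

Local Open Scope ring_scope.

(** Write [n] for the degree of [L] over [K] and [theta] for the residue of [eta].
    The minimal polynomial of [theta] over [Kv] has degree [n], so a polynomial
    over [Kv] of degree less than [n] that vanishes at [theta] is zero.  After
    division by a coefficient of least value, this makes [nu] the Gauss
    valuation in degrees less than [n] ([nu_le]).  Hence the ring of [v] is
    generated by [eta] over that of [K] ([valring_gen]), and the minimal
    polynomial [g] of [eta] is integral and reduces to that of [theta]
    ([monic_integral], [reduction_minPoly]).

    Differentials: they are generated by [d eta], and [g'(eta) d eta = 0]; if
    [theta] is separable then [g'(eta)] is a unit, so they all vanish.
    Conversely a derivation of [Lv] over [Kv], composed with the residue map,
    is a derivation of the ring of [v] into [Lv], so it factors through the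
    differentials; if these vanish then [Lv] has no derivation over [Kv] but
    zero, and [theta] is separable.

    Key polynomials: if a nonconstant [f] has [delta f > 0], some root [b] of
    [f] satisfies [nubar (X - b) > 0], that is, [b] has the same residue as
    [eta].  A multiple of [f] that is integral with nonzero reduction then has
    [theta] as a root of its reduction, so [f] has degree at least [n].  As
    [delta X >= 0], every key polynomial of degree greater than one has
    positive [delta], and [g] bounds its degree.  The key polynomials for
    [Psi_1] are therefore the monic polynomials of degree [n] and positive
    value ([key_poly_Psi1E]), which are the monic integral lifts of the minimal
    polynomial of [theta].

    Exponents: a [Q] of maximal value is [X - c] with [c] integral, and the
    [Q]-expansion of [F] is its Taylor expansion at [c].  A truncation of that
    expansion is again a key polynomial for [Psi_1] exactly when it keeps the
    leading term and its reduction is unchanged; so the exponents in a minimal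
    [B] are those of the positive powers of [X - cv] that occur in the minimal
    polynomial of [theta].  They are all multiples of [p] exactly when the
    derivative of that polynomial is zero, that is, when [theta] is inseparable
    ([separable_exponents]). *)

(** * Derivations into the residue field *)

Section ResidueModule.
Variables (F : fieldType) (G : orderedAbGroupType) (v : valuation F G).

(** An alias carrying the action of the valuation ring through residues, the
    target of derivations obtained from those of the residue field. *)
Definition resmodule : Type := resfield v.
HB.instance Definition _ := GRing.Zmodule.on resmodule.

Definition resmodule_scale (b : valring v) (x : resmodule) : resmodule :=
  (res v b : resfield v) * x.

Fact resmodule_scaleA a b x :
  resmodule_scale a (resmodule_scale b x) = resmodule_scale (a * b) x.
Proof. by rewrite /resmodule_scale rmorphM mulrA. Qed.
Fact resmodule_scale1 : left_id 1 resmodule_scale.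
Proof. by move=> x; rewrite /resmodule_scale rmorph1 mul1r. Qed.
Fact resmodule_scaleDr : right_distributive resmodule_scale +%R.
Proof. by move=> a x y; rewrite /resmodule_scale mulrDr. Qed.
Fact resmodule_scaleDl x : {morph resmodule_scale^~ x : a b / a + b}.
Proof. by move=> a b; rewrite /resmodule_scale rmorphD mulrDl. Qed.
HB.instance Definition _ := GRing.Zmodule_isLmodule.Build (valring v) resmodule
  resmodule_scaleA resmodule_scale1 resmodule_scaleDr resmodule_scaleDl.
End ResidueModule.

(** A derivation [D] of the residue field lifts to [x |-> D (res x)], which the
    universal property sends to a linear map on the zero module; so [D = 0],
    and the absence of derivations characterises separability. *)
Lemma kahler0_separable (K : fieldType) (L : fieldExtType K)
    (G : orderedAbGroupType) (v : valuation L G) (theta : resext v) :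
  <<1; theta>>%VS = {:resext v}%VS ->
  (forall w : kahler (vincl v), w = 0) -> separable_element 1 theta.
Proof.
move=> gen w0; apply/Derivation_separableP => D derD /subvP D1.
pose DO (x : valring v) : resmodule v := D (res v x).
have der : is_derivation (vincl v) DO.
  split=> [x y|x y|a].
  - by rewrite /DO rmorphD linearD.
  - rewrite /DO rmorphM (Derivation_mul derD) ?gen ?memvf //.
    by rewrite addrC [D _ * _]mulrC.
  - have : (res v (vincl v a) : resext v) \in (1%VS : {vspace resext v}).
      apply/vlineP; exists (res (valbase v) a).
      by rewrite -resinclE; apply/esym/mulr1.
    by move/D1; rewrite memv_ker => /eqP.
have [h hE] := kahler_univ der.
apply/subvP => y _; have [x <-] := res_surj (y : resfield v).
have D0 : DO x = 0.
  by rewrite -(linear0 h) -(w0 (kahler_d _ x)); apply: esym (hE x).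
by rewrite memv_ker; apply/eqP.
Qed.


(** * Expansions in powers of a linear polynomial *)

(** Division by a power of [X - c] cuts the Taylor expansion at [c], and the
    remainder modulo [X - c] is the value at [c]. *)
Lemma Qcoef_XsubC (F : fieldType) (c : F) (f : {poly F}) l :
  Qcoef ('X - c%:P) f l = ((f \Po ('X + c%:P))`_l)%:P.
Proof.
set t := f \Po _; set q := 'X - c%:P.
have Ef : f = (drop_poly l t \Po q) * q ^+ l + (take_poly l t \Po q).
  rewrite -{1}[f](comp_polyXaddC_K f c) -/t -{1}(poly_take_drop l t) comp_polyD.
  by rewrite comp_polyM rmorphXn /= comp_polyX addrC.
rewrite /Qcoef {1}Ef divp_addl_mul_small; last first.
  by rewrite size_comp_poly2 ?size_XsubC // size_exp_XsubC ltnS size_take_poly.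
by rewrite modp_XsubC horner_comp !hornerE subrr horner_coef0 coef_drop_poly.
Qed.

Lemma subexpansion_XsubC (F : fieldType) (c : F) (f : {poly F}) (B : set nat) :
  f != 0 ->
  subexpansion ('X - c%:P) f B =
  (\poly_(l < size f) if (l == 0) || (l \in B) then (f \Po ('X + c%:P))`_l else 0)
    \Po ('X - c%:P).
Proof.
rewrite -size_poly_gt0 /subexpansion => szf.
pose t l := if (l == 0) || (l \in B) then (f \Po ('X + c%:P))`_l else 0.
rewrite poly_def rmorph_sum /= -(big_mkord xpredT (fun l => t l *: 'X^l \Po _)).
rewrite big_ltn //=.
rewrite Qcoef_XsubC expr0 alg_polyC comp_polyC; congr (_ + _).
rewrite big_mkcond /=; apply: eq_big_nat => l /andP[l0 _].
rewrite /t gtn_eqF //=; case: ifP => _; last by rewrite scale0r comp_poly0.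
by rewrite Qcoef_XsubC comp_polyZ rmorphXn /= comp_polyX mul_polyC.
Qed.

(** * Sums, powers and products under a valuation *)

Section Values.
Variables (R : comNzRingType) (G : orderedAbGroupType) (v : valuation R G).

Lemma val_sum_ge (I : Type) (s : seq I) (P : pred I) (x : I -> R) c :
  (forall i, P i -> c <= v (x i)) -> c <= v (\sum_(i <- s | P i) x i).
Proof.
move=> cx; apply: (big_ind (fun y => c <= v y)) => //.
- by rewrite val0; case: (c).
- by move=> y z; apply: valD_ge.
Qed.

Lemma val_exp_ge0 x i : vfin 0 <= v x -> vfin 0 <= v (x ^+ i).
Proof.
move=> x0; elim: i => [|i IHi]; first by rewrite expr0 val1.
by rewrite exprS valM vadd_ge0.
Qed.

Lemma val_mulr_ge c x y : c <= v x -> vfin 0 <= v y -> c <= v (x * y).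
Proof.
rewrite valM; case: (v x) (v y) c => [a|] [b|] [c|] //; rewrite /Order.le /=.
by move=> ca b0; apply: le_trans ca _; rewrite -{1}[a]addr0; apply: oag_leD2l.
Qed.

Lemma val_mulr_gt0 x y : vfin 0 < v x -> vfin 0 <= v y -> vfin 0 < v (x * y).
Proof. by move=> x0 y0; rewrite mulrC valM vadd_gt0. Qed.

Lemma val_sum_gt0 (I : Type) (s : seq I) (P : pred I) (x : I -> R) :
  (forall i, P i -> vfin 0 < v (x i)) -> vfin 0 < v (\sum_(i <- s | P i) x i).
Proof.
move=> cx; apply: (big_ind (fun y => vfin 0 < v y)) => //.
- by rewrite val0.
- by move=> y z; apply: valD_gt.
Qed.

(** Congruence modulo the elements of positive value is compatible with powers
    of elements of nonnegative value. *)
Lemma val_subX_gt0 x y i : vfin 0 <= v x -> vfin 0 <= v y ->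
  vfin 0 < v (x - y) -> vfin 0 < v (x ^+ i - y ^+ i).
Proof.
move=> x0 y0 xy; rewrite subrXX; apply: val_mulr_gt0 => //.
by apply: val_sum_ge => k _; rewrite valM vadd_ge0 // val_exp_ge0.
Qed.

Lemma val_prod_gt0 (s : seq R) :
  vfin 0 < v (\prod_(x <- s) x) -> exists2 x, x \in s & vfin 0 < v x.
Proof.
elim: s => [|x s IHs]; first by rewrite big_nil val1 ltxx.
rewrite big_cons valM => h; have [x0|x0] := ltP (vfin 0) (v x).
  by exists x; rewrite ?mem_head.
have [|y ys y0] := IHs; last by exists y; rewrite ?in_cons ?ys ?orbT.
apply: lt_le_trans h _; case: (v x) x0 (v (\prod_(_ <- s) _)) => [a|] // a0 [b|] //.
by rewrite /Order.le /= -{2}[b]addr0 [a + b]addrC; apply: oag_leD2l.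
Qed.

Lemma val_prod_infty (s : seq R) :
  v (\prod_(x <- s) x) = vinfty -> exists2 x, x \in s & v x = vinfty.
Proof.
elim: s => [|x s IHs]; first by rewrite big_nil val1.
rewrite big_cons valM => h; case E: (v x) h => [a|].
  case E' : (v _) => // _; have [y ys y0] := IHs E'.
  by exists y; rewrite ?in_cons ?ys ?orbT.
by exists x; rewrite ?mem_head.
Qed.

End Values.

(** * Reduction of integral polynomials *)

Section PurelyInertial.
Variables (K : fieldType) (L : fieldExtType K) (G : orderedAbGroupType).
Variables (v : valuation L G) (eta : valring v).

Local Notation O := (valring (valbase v)).
Local Notation theta := (res v eta : resext v).
Local Notation nu := (valcomp (horner_alg (val eta)) v).
Local Notation n := (\dim {:L}).

Hypothesis theta_gen : <<1; theta>>%VS = {:resext v}%VS.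
Hypothesis dim_eq : \dim {:L} = \dim {:resext v}.

Implicit Types (P : {poly O}) (f : {poly K}).

(** A constant, so that the polynomials over [K] with integral coefficients are
    recognised whichever structure the inclusion is read in. *)
Definition intpoly P : {poly K} := map_poly val P.

Lemma coef_intpoly P i : (intpoly P)`_i = val P`_i.
Proof. by rewrite coef_map_id0. Qed.

Definition reduction P : {poly resext v} := map_poly (res v \o vincl v) P.

Lemma val_intpoly P :
  val (map_poly (vincl v) P).[eta] = horner_alg (val eta) (intpoly P).
Proof.
rewrite -horner_map /= /horner_alg /horner_morph; congr (_.[_]).
by apply/polyP => i; rewrite !(coef_map, coef_intpoly, coef_map_id0).
Qed.

Lemma res_intpoly P : res v (map_poly (vincl v) P).[eta] = (reduction P).[theta].
Proof. by rewrite -horner_map /reduction map_poly_comp. Qed.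

Lemma nu_gt0E P : (vfin 0 < nu (intpoly P)) = root (reduction P) theta.
Proof. by rewrite /root -res_intpoly res_eq0 val_intpoly. Qed.

Lemma reduction_over P : reduction P \is a polyOver 1%VS.
Proof.
apply/polyOver1P; exists (map_poly (res (valbase v)) P).
apply/polyP => i; rewrite !coef_map /= -resinclE.
exact: esym (mulr1 _).
Qed.

Lemma intpolyP f : (forall i, vfin 0 <= valbase v f`_i) ->
  exists P, f = intpoly P.
Proof.
move=> f0; exists (\poly_(i < size f) insubd 0 f`_i).
apply/polyP => i; rewrite coef_intpoly coef_poly.
case: ltnP => [_|ls]; last by rewrite nth_default.
rewrite [RHS](@insubdK _ _ (valring (valbase v))) //; exact: f0.
Qed.

Lemma theta_deg : adjoin_degree 1 theta = n.
Proof. by rewrite dim_eq -theta_gen dim_Fadjoin dimv1 muln1. Qed.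

(** The scalar is a coefficient of least value: dividing by it leaves the
    other coefficients integral and makes that one equal to [1]. *)
Lemma primitive_multiple f : f != 0 -> exists c P,
  [/\ f = c *: intpoly P & reduction P != 0].
Proof.
move=> f0; have sz0 : (0 < size f)%N by rewrite size_poly_gt0.
have [k kP] : exists k, forall l, valbase v f`_k <= valbase v f`_l.
  exists [arg min_(k < Ordinal sz0) valbase v f`_k]%O => l.
  case: arg_minP => // m _ mP.
  have [ls|ls] := ltnP l (size f); first exact: (mP (Ordinal ls)).
  by rewrite (nth_default _ ls) [valbase v 0]val0; case: (valbase v _).
have fk0 : f`_k != 0.
  apply/eqP => E; have := kP (size f).-1.
  have [c ->] : exists c, valbase v f`_(size f).-1 = vfin c.
    by apply: val_fin; rewrite -/(lead_coef f) lead_coef_eq0.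
  by rewrite E val0.
have [|P EP] := @intpolyP ((f`_k)^-1 *: f).
  by move=> l; rewrite coefZ mulrC; apply: val_div.
exists f`_k, P; split; first by rewrite -EP scalerA mulfV // scale1r.
apply/eqP => /polyP/(_ k); rewrite coef0 coef_map /= => /eqP.
have := congr1 (fun q : {poly K} => q`_k) EP.
rewrite /= coefZ mulVf // coef_intpoly => Pk.
by rewrite res_eq0 /= -Pk scale1r val1 ltxx.
Qed.

Lemma size_reduction_root P :
  reduction P != 0 -> root (reduction P) theta -> (n < size (reduction P))%N.
Proof.
move=> P0 rP; rewrite ltnNge -theta_deg; apply/negP => szP.
by move: rP; rewrite (root_small_adjoin_poly (reduction_over P) szP) (negPf P0).
Qed.

Lemma size_reduction P : (size (reduction P) <= size P)%N.
Proof. by rewrite /reduction map_polyE (leq_trans (size_Poly _)) ?size_map. Qed.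

Lemma size_intpoly P : size (intpoly P) = size P.
Proof. by rewrite /intpoly (size_map_inj_poly val_inj). Qed.

Lemma nu_scale c f : nu (c *: f) = vadd (valbase v c) (nu f).
Proof. by rewrite -mul_polyC valM /= horner_algC. Qed.

(** Since nothing nonzero of degree less than [n] over [Kv] vanishes at
    [theta], the primitive multiple of [f] has value zero: values of polynomials
    of degree less than [n] are given by the Gauss valuation. *)
Lemma nu_le f i : (size f <= n)%N -> nu f <= valbase v f`_i.
Proof.
have [-> _|/primitive_multiple[c [P [-> P0]]] szf] := eqVneq f 0.
  by rewrite coef0 [valbase v 0]val0; case: (nu 0).
have [->|c0] := eqVneq c 0.
  by rewrite scale0r coef0 [valbase v 0]val0; case: (nu 0).
have : ~~ (vfin 0 < nu (intpoly P)).
  rewrite nu_gt0E; apply/negP => /(size_reduction_root P0); apply/negP.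
  rewrite -leqNgt (leq_trans (size_reduction P)) //.
  by rewrite -size_intpoly -(size_scale _ c0).
rewrite -leNgt coefZ nu_scale => nuP.
apply: (@le_trans _ _ (valbase v c)); last first.
  by apply: val_mulr_ge; rewrite // coef_intpoly; apply: vrvalP.
case: (nu _) nuP (valbase v c) => [a|] // a0 [b|] //.
by rewrite /Order.le /= -{2}[b]addr0; apply: oag_leD2l.
Qed.

(** [eta] generates [L]: a monic relation of smaller degree would have infinite
    value, but by [nu_le] its value is at most that of its leading coefficient. *)
Lemma eta_deg : adjoin_degree 1 (val eta) = n.
Proof.
have /polyOver1P[g Eg] := minPolyOver 1%AS (val eta).
apply/anti_leq/andP; split.
  have := dim_Fadjoin 1%AS (val eta); rewrite dimv1 muln1 => <-.
  exact/dimvS/subvf.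
rewrite leqNgt; apply/negP => h; have szg : (size g <= n)%N.
  by rewrite -(size_map_poly (in_alg L)) -Eg size_minPoly.
have := nu_le (size g).-1 szg.
have gm : g \is monic by rewrite -(map_monic (in_alg L)) -Eg monic_minPoly.
rewrite -/(lead_coef g) (monicP gm) (val1 (valbase v)) /=.
by rewrite /horner_alg /horner_morph -Eg minPolyxx val0.
Qed.

Lemma eta_minpoly : exists g : {poly K},
  [/\ g \is monic, size g = n.+1 & horner_alg (val eta) g = 0].
Proof.
have /polyOver1P[g Eg] := minPolyOver 1%AS (val eta); exists g; split.
- by rewrite -(map_monic (in_alg L)) -Eg monic_minPoly.
- by rewrite -(size_map_poly (in_alg L)) -Eg size_minPoly eta_deg.
- by rewrite /horner_alg /horner_morph -Eg minPolyxx.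
Qed.

(** The Gauss bound applies to [f - X^n], whose degree is less than [n]. *)
Lemma monic_integral f : f \is monic -> size f = n.+1 -> vfin 0 <= nu f ->
  exists2 P : {poly O}, f = intpoly P & P \is monic.
Proof.
move=> fm szf f0.
have sz1 : (size (f - 'X^n)%R <= n)%N.
  apply/leq_sizeP => i; rewrite leq_eqVlt => /orP[/eqP<-|ni].
    have := monicP fm; rewrite /lead_coef szf /= coefB coefXn eqxx => ->.
    by rewrite subrr.
  by rewrite coefB coefXn gtn_eqF // nth_default ?szf // subr0.
have [i|P EP] := @intpolyP f.
  rewrite -[f](subrK 'X^n) coefD; apply: valD_ge.
    apply: le_trans (nu_le i sz1); apply: valD_ge => //.
    by rewrite valN /= rmorphXn /= horner_algX; apply/val_exp_ge0/vrvalP.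
  rewrite coefXn; case: eqP => _; first by rewrite (val1 (valbase v)).
  by rewrite (val0 (valbase v)).
exists P => //; have szP : size P = n.+1.
  by rewrite -size_intpoly -EP.
apply/eqP/val_inj; rewrite /lead_coef szP.
by have := monicP fm; rewrite /lead_coef szf /= EP coef_intpoly => ->.
Qed.

Lemma reduction_minPoly P : P \is monic -> size P = n.+1 ->
  vfin 0 < nu (intpoly P) -> reduction P = minPoly 1 theta.
Proof.
move=> Pm szP; rewrite nu_gt0E => /(minPoly_dvdp (reduction_over P)) mP.
have rm : reduction P \is monic by apply: monic_map.
apply/esym/eqP; rewrite -eqp_monic ?monic_minPoly // -dvdp_size_eqp //.
rewrite size_minPoly theta_deg -szP /reduction size_map_poly_id0 //.
by rewrite (monicP Pm) rmorph1 oner_eq0.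
Qed.

(** * Differentials *)

Lemma separableE : separable 1%VS {:resext v}%VS = separable_element 1 theta.
Proof.
apply/idP/idP => [/separableP|/adjoin_separableP s]; first by apply; apply: memvf.
by apply/separableP => y _; apply: s; rewrite theta_gen memvf.
Qed.

(** The coordinates of [y] on the powers of [eta] are integral by [nu_le]. *)
Lemma valring_gen (y : valring v) : exists P, y = (map_poly (vincl v) P).[eta].
Proof.
have gen : <<1; val eta>>%VS = {:L}%VS.
  by apply/eqP; rewrite eqEdim subvf /= dim_Fadjoin eta_deg dimv1 muln1.
have /polyOver1P[f Ef] := Fadjoin_polyOver 1%AS (val eta) (val y).
have fy : horner_alg (val eta) f = val y.
  by rewrite /horner_alg /horner_morph -Ef Fadjoin_poly_eq // gen memvf.
have [i|P EP] := @intpolyP f.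
  apply: le_trans (nu_le i _); first by rewrite /= fy; apply: vrvalP.
  by rewrite -eta_deg -(size_map_poly (in_alg L)) -Ef size_Fadjoin_poly.
by exists P; apply: val_inj; rewrite val_intpoly -EP fy.
Qed.

Lemma derivation_intpoly (N : lmodType (valring v)) (D : valring v -> N) P :
  is_derivation (vincl v) D ->
  D (map_poly (vincl v) P).[eta] = (map_poly (vincl v) P^`()).[eta] *: D eta.
Proof.
case=> DD DM D0; elim/poly_ind: P => [|P c IHP].
  by rewrite deriv0 !rmorph0 horner0 scale0r -(rmorph0 (vincl v)) D0.
rewrite derivMXaddC !rmorphD !rmorphM /= map_polyX map_polyC !hornerE DD D0 DM.
by rewrite addr0 IHP scalerDl scalerA addrC [eta * _]mulrC addrC.
Qed.

(** Applying the universal derivation to [g(eta) = 0], for [g] the minimal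
    polynomial of [eta], gives [g'(eta) d eta = 0], where the residue of
    [g'(eta)] is the value at [theta] of the derivative of the minimal polynomial
    of [theta]. *)
Lemma separable_kahler0 : separable 1%VS {:resext v}%VS ->
  forall w : kahler (vincl v), w = 0.
Proof.
rewrite separableE => sep.
have [g [gm szg g0]] := eta_minpoly.
have [|P EP Pm] := monic_integral gm szg; first by rewrite /= g0 val0.
have szP : size P = n.+1.
  by rewrite -size_intpoly -EP.
have rP : reduction P = minPoly 1 theta.
  by apply: reduction_minPoly; rewrite -?EP //= g0 val0.
have derd := kahler_d_derivation (vincl v).
have deta : kahler_d (vincl v) eta = 0.
  have := derivation_intpoly P derd.
  have -> : (map_poly (vincl v) P).[eta] = 0.
    by apply: val_inj; rewrite val_intpoly -EP g0 rmorph0.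
  have [_ _ /(_ 0)] := derd; rewrite rmorph0 => ->.
  set u := (_).[eta]; have u0 : res v u != 0.
    have := separable_root_der 1%AS theta; rewrite sep /= -rP.
    by rewrite /u res_intpoly /root /reduction deriv_map.
  pose u' : valring v := ValRing (unit_inv_subproof u0).
  move/(congr1 (fun w => u' *: w)); rewrite scaler0 scalerA.
  have -> : u' * u = 1.
    apply: val_inj; rewrite rmorphM rmorph1 /= mulVf //.
    by apply/eqP => E; move: (u0); rewrite res_eq0 /= E val0.
  by rewrite scale1r.
move=> w; have [m [c [x ->]]] := kahler_gen w.
apply: big1 => i _; have [Q ->] := valring_gen (x i).
by rewrite (derivation_intpoly Q derd) deta !scaler0.
Qed.

(** * Key polynomials of degree greater than one *)

Section KeyPolynomials.
Variables (Kbar : closedFieldType) (iota : {rmorphism K -> Kbar}).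
Variables (G' : orderedAbGroupType) (j : {additive G -> G'}).
Variable nubar : valuation {poly Kbar} G'.
Hypothesis j_mono : {mono j : x y / x <= y}.
Hypothesis nubarE : forall f : {poly K}, nubar (map_poly iota f) = omap j (nu f).

Local Notation delta := (delta iota nubar).
Local Notation key_poly_Psi1 := (key_poly_Psi1 iota nubar).

Lemma nubar_ge0 f : (vfin 0 <= nubar (map_poly iota f)) = (vfin 0 <= nu f).
Proof.
rewrite nubarE; case: (nu f) => // a; rewrite /Order.le /= -(raddf0 j).
exact: j_mono.
Qed.

Lemma nubar_gt0 f : (vfin 0 < nubar (map_poly iota f)) = (vfin 0 < nu f).
Proof.
rewrite nubarE; case: (nu f) => // a; rewrite /Order.lt /= /vlt /=.
rewrite -(raddf0 j) j_mono /eq_op /=; congr (~~ _ && _).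
by rewrite inj_eq //; apply: inc_inj.
Qed.

Lemma delta_mem f : (1 < size f)%N ->
  exists2 b, root (map_poly iota f) b & delta f = nubar ('X - b%:P).
Proof.
move=> szf; have f0 : f != 0 by rewrite -size_poly_gt0 ltnW.
have [b fb] : exists b, b \in kroots iota f.
  have : size (map_poly iota f) != 1%N by rewrite size_map_poly gtn_eqF.
  by case/closed_rootP => b fb; exists b; rewrite mem_kroots.
rewrite /Defs.delta; set s := map _ _.
suff /mapP[a af ->] : \big[Order.max/head vinfty s]_(d <- s) d \in s.
  by exists a; rewrite // -mem_kroots.
have hs : head vinfty s \in s.
  by rewrite /s; case: (kroots iota f) fb => //= x t _; apply: mem_head.
rewrite big_seq; apply: (big_ind (fun d => d \in s)) => // x y xs ys.
by rewrite maxElt; case: ifP.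
Qed.

Lemma delta_ge f b : f != 0 -> root (map_poly iota f) b ->
  nubar ('X - b%:P) <= delta f.
Proof.
move=> f0 fb; apply: (@le_bigmax_seq _ _ _ _ _ (nubar ('X - b%:P)) xpredT id) => //.
by apply/mapP; exists b; rewrite ?mem_kroots.
Qed.

Lemma map_prod_kroots f : f \is monic ->
  map_poly iota f = \prod_(x <- [seq 'X - b%:P | b <- kroots iota f]) x.
Proof.
move=> fm; rewrite big_map /kroots; case: closed_field_poly_normal => r /= ->.
by rewrite lead_coef_map (monicP fm) rmorph1 scale1r.
Qed.

(** A product of elements of value at most zero has value at most zero, so a
    polynomial of positive value has a linear factor of positive value. *)
Lemma delta_gt0 f : f \is monic -> vfin 0 < nu f -> vfin 0 < delta f.
Proof.
move=> fm; rewrite -nubar_gt0 map_prod_kroots // => /val_prod_gt0[_ /mapP[b fb ->]].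
have f0 := monic_neq0 fm.
by move/lt_le_trans; apply; apply: delta_ge; rewrite -?mem_kroots.
Qed.

(** A product of elements of finite value has finite value. *)
Lemma delta_infty f : f \is monic -> nu f = vinfty -> delta f = vinfty.
Proof.
move=> fm nuf; have := nubarE f; rewrite nuf map_prod_kroots //.
case/val_prod_infty => _ /mapP[b fb ->] E.
have f0 := monic_neq0 fm.
have := @delta_ge f b f0; rewrite -mem_kroots // => /(_ fb).
by rewrite E; case: (delta f).
Qed.

(** Here [X] and [b] are integral and congruent for [nubar], so [f] and
    [f(b) = 0] are congruent. *)
Lemma nu_gt0_close P b : root (map_poly iota (intpoly P)) b ->
  vfin 0 < nubar ('X - b%:P) -> vfin 0 < nu (intpoly P).
Proof.
set f := intpoly P => fb close; rewrite -nubar_gt0.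
have X0 : vfin 0 <= nubar 'X.
  by rewrite -(map_polyX iota) nubar_ge0 /= horner_algX; apply: vrvalP.
have b0 : vfin 0 <= nubar b%:P.
  rewrite -[b%:P](subKr 'X); apply: valD_ge => //; rewrite valN; exact: ltW.
(* After subtraction of the value at the root [b]. *)
have -> : map_poly iota f =
    \sum_(i < size f) (iota f`_i)%:P * ('X ^+ i - b%:P ^+ i).
  rewrite (eq_bigr (fun i : 'I__ =>
    (iota f`_i)%:P * 'X^i - (iota f`_i * b ^+ i)%:P)).
    rewrite sumrB -rmorph_sum /=.
    have -> : \sum_(i < size f) iota f`_i * b ^+ i = (map_poly iota f).[b].
      rewrite horner_coef size_map_poly; apply: eq_bigr => i _.
      by rewrite (coef_map iota).
    rewrite (rootP fb) subr0 -[LHS]coefK size_map_poly poly_def.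
    by apply: eq_bigr => i _; rewrite (coef_map iota) mul_polyC.
  by move=> i _; rewrite mulrBr rmorphM rmorphXn.
apply: val_sum_gt0 => i _; rewrite mulrC; apply: val_mulr_gt0.
  exact: val_subX_gt0.
rewrite -map_polyC nubar_ge0 /= horner_algC.
by rewrite /f coef_intpoly; apply: (vrvalP P`_i).
Qed.

Lemma delta_gt0_reduction f : (1 < size f)%N -> vfin 0 < delta f ->
  exists c P, [/\ f = c *: intpoly P, reduction P != 0 &
                  root (reduction P) theta].
Proof.
move=> szf; have f0 : f != 0 by rewrite -size_poly_gt0 ltnW.
have [b fb ->] := delta_mem szf; move=> close.
have [c [P [fE P0]]] := primitive_multiple f0.
exists c, P; split=> //; rewrite -nu_gt0E; apply: nu_gt0_close close.
move: fb; rewrite fE -mul_polyC rmorphM /= map_polyC rootM rootC fmorph_eq0.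
by case: eqP => // c0; move: f0; rewrite fE c0 scale0r eqxx.
Qed.

Lemma delta_gt0_size f : (1 < size f)%N -> vfin 0 < delta f -> (n < size f)%N.
Proof.
move=> szf /(delta_gt0_reduction szf)[c [P [fE P0 rP]]].
have c0 : c != 0 by apply: contraTneq szf => c0; rewrite fE c0 scale0r size_poly0.
rewrite fE size_scale // size_intpoly.
exact: leq_trans (size_reduction_root P0 rP) (size_reduction P).
Qed.

(** The primitive multiple of [f] has degree [n], and its reduction vanishes at
    [theta], so has degree [n] too.  Its leading coefficient is thus a unit, so
    the scalar has value zero. *)
Lemma delta_gt0_nu f : f \is monic -> size f = n.+1 -> (1 < size f)%N ->
  vfin 0 < delta f -> vfin 0 < nu f.
Proof.
move=> fm szn szf /(delta_gt0_reduction szf)[c [P [fE P0 rP]]].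
have szP := size_reduction_root P0 rP.
have c0 : c != 0 by apply: contraTneq szf => c0; rewrite fE c0 scale0r size_poly0.
have szP' : size P = n.+1 by rewrite -szn fE size_scale // size_intpoly.
have Pn : c * val P`_n = 1.
  have := monicP fm; rewrite /lead_coef szn /= fE coefZ => <-.
  by rewrite coef_intpoly.
have Pn0 : valbase v (val P`_n) = vfin 0.
  apply/le_anti/andP; split; last exact: vrvalP.
  rewrite leNgt -res_eq0; apply/negP => /eqP r0.
  move: szP; rewrite ltnNge; apply/negP/negPn/leq_sizeP => i.
  rewrite leq_eqVlt coef_map => /orP[/eqP<-|ni] /=.
    by rewrite -resinclE r0 rmorph0.
  by rewrite nth_default ?szP' // !rmorph0.
rewrite fE nu_scale; have -> : valbase v c = vfin 0.
  have := valM (valbase v) c (val P`_n); rewrite Pn Pn0 (val1 (valbase v)).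
  by case: (valbase v c) => //= a; rewrite addr0 => ->.
by rewrite vadd0 nu_gt0E.
Qed.

Lemma delta_X_ge0 : vfin 0 <= delta 'X.
Proof.
have := @delta_ge 'X 0 (negbT (polyX_eq0 _)); rewrite map_polyX rootX eqxx subr0.
move=> /(_ isT); apply: le_trans.
by rewrite -(map_polyX iota) nubar_ge0 /= horner_algX; apply: vrvalP.
Qed.

(** [F] must have greater [delta] than the linear polynomial [X]. *)
Lemma key_poly_gt0 F : Defs.key_poly iota nubar F -> (2 < size F)%N ->
  vfin 0 < delta F.
Proof.
case=> _ _ keyF F2; apply: le_lt_trans delta_X_ge0 _.
rewrite ltNge; apply/negP => /keyF; rewrite size_polyX => /(_ isT).
by rewrite leqNgt F2.
Qed.

(** The degree is at least [n] by [delta_gt0_size], and at most [n] because the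
    minimal polynomial of [eta] has infinite [delta]. *)
Lemma key_poly_Psi1E F : (1 < n)%N ->
  key_poly_Psi1 F <-> [/\ F \is monic, size F = n.+1 & vfin 0 < nu F].
Proof.
move=> n1; split=> [[keyF F2 minF]|[Fm szF nuF]].
  have dF := key_poly_gt0 keyF F2; have [Fm F1 keyF'] := keyF.
  have szF : size F = n.+1.
    apply/anti_leq/andP; split; last exact: delta_gt0_size.
    have [g [gm szg g0]] := eta_minpoly; rewrite -szg.
    apply: keyF'; first by rewrite szg ltnS ltnW.
    by rewrite (delta_infty gm); [case: (delta F) | rewrite /= g0 val0].
  by split=> //; apply: delta_gt0_nu.
have F1 : (1 < size F)%N by rewrite szF ltnS ltnW.
have dF := delta_gt0 Fm nuF; split; last 2 first.
- by rewrite szF.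
- by move=> F' keyF' F'2; rewrite szF delta_gt0_size ?(ltnW F'2) ?key_poly_gt0.
split=> // f f1 dFf; rewrite szF; apply: delta_gt0_size => //.
exact: lt_le_trans dFf.
Qed.

(** When [n = 1] there is a linear polynomial of infinite [delta], and no key
    polynomial of greater degree. *)
Lemma key_poly_Psi1_deg F : key_poly_Psi1 F -> (1 < n)%N.
Proof.
case=> keyF F2 _; have [_ _ keyF'] := keyF.
have [g [gm szg g0]] := eta_minpoly.
rewrite -ltnS -szg; apply: leq_trans F2 _; apply: keyF'.
  by rewrite szg ltnS adim_gt0.
by rewrite (delta_infty gm); [case: (delta F) | rewrite /= g0 val0].
Qed.


(** * Exponents of minimal key polynomials *)

(** The maximal value is at least that of [X], so [eta - c] and hence [c] are
    integral. *)
Lemma max_in_Psi1_XsubC (Q : {poly K}) : max_in_Psi1 iota nu nubar Q ->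
  exists c : O, Q = 'X - (val c)%:P.
Proof.
case=> [[[Qm _ _] szQ] maxQ].
have QE : Q = 'X - (- Q`_0)%:P.
  apply/polyP => -[|[|i]]; rewrite coefD coefX coefN coefC /=.
  - by rewrite opprK add0r.
  - by rewrite subr0; have := monicP Qm; rewrite /lead_coef szQ.
  - by rewrite subr0 nth_default ?szQ.
have X1 : Psi iota nubar 1 'X.
  by split; [split; rewrite ?monicX ?size_polyX|rewrite size_polyX].
have Q0 : vfin 0 <= nu Q.
  by apply: le_trans (maxQ _ X1); rewrite /= horner_algX; apply: vrvalP.
have c0 : - Q`_0 \in valpred (valbase v).
  have -> : (- Q`_0 \in valpred (valbase v)) = (vfin 0 <= nu (- Q`_0)%:P).
    by rewrite /= horner_algC.
  rewrite -[(- Q`_0)%:P](subKr 'X) -QE; apply: valD_ge; last by rewrite valN.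
  by rewrite /= horner_algX; apply: vrvalP.
by exists (ValRing c0).
Qed.

Lemma intpoly_monic P : (intpoly P \is monic) = (P \is monic).
Proof.
by rewrite !monicE /intpoly (lead_coef_map_inj val_inj) // -(rmorph1 (val : O -> K)).
Qed.

Lemma map_shift P (c : O) :
  intpoly (P \Po ('X - c%:P)) =
  intpoly P \Po ('X - (val c)%:P).
Proof. by rewrite /intpoly (map_comp_poly val) (map_polyXsubC val). Qed.

Lemma reduction_shift P (c : O) : reduction (P \Po ('X - c%:P)) =
  reduction P \Po ('X - (res v (vincl v c) : resext v)%:P).
Proof. by rewrite /reduction map_comp_poly map_polyXsubC. Qed.

(** The criterion [key_poly_Psi1E] for a polynomial given by the coefficients of
    its expansion in powers of [X - c]. *)
Lemma key_poly_Psi1_shift (T : {poly O}) (c : O) : (1 < n)%N -> (size T <= n.+1)%N ->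
  key_poly_Psi1 (intpoly (T \Po ('X - c%:P))) <->
  T`_n = 1 /\
  reduction T \Po ('X - (res v (vincl v c) : resext v)%:P) = minPoly 1 theta.
Proof.
move=> n1 szT; rewrite key_poly_Psi1E // -reduction_shift intpoly_monic.
have szE : size (T \Po ('X - c%:P)) = size T.
  rewrite -[LHS]size_intpoly map_shift size_comp_poly2 ?size_XsubC //.
  exact: size_intpoly.
have mE : (T \Po ('X - c%:P) \is monic) = (T \is monic).
  rewrite -[LHS]intpoly_monic map_shift monicE lead_coef_comp ?size_XsubC //.
  by rewrite lead_coefXsubC expr1n mulr1 -monicE intpoly_monic.
rewrite size_intpoly; split=> [[Tm sz nuT]|[Tn rT]].
  split; last exact: reduction_minPoly.
  by move: Tm; rewrite mE monicE /lead_coef -szE sz => /eqP.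
have sz : size T = n.+1.
  apply/anti_leq; rewrite szT ltnNge; apply/negP => /leq_sizeP/(_ n (leqnn n)).
  by rewrite Tn => /eqP; rewrite oner_eq0.
split; rewrite ?mE ?szE //; first by rewrite monicE /lead_coef sz Tn.
by rewrite nu_gt0E rT root_minPoly.
Qed.

Definition truncation P (B : set nat) : {poly O} :=
  \poly_(l < n.+1) if (l == 0) || (l \in B) then P`_l else 0.

(** The constant term is kept whatever [B] is, as in [subexpansion]. *)
Lemma subexpansion_truncation P (c : O) B : size P = n.+1 ->
  subexpansion ('X - (val c)%:P) (intpoly P) B =
  intpoly (truncation (P \Po ('X + c%:P)) B \Po ('X - c%:P)).
Proof.
move=> szP; rewrite subexpansion_XsubC -?size_poly_gt0 ?size_intpoly ?szP //.
rewrite map_shift; congr (_ \Po _); apply/polyP => l.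
rewrite coef_poly coef_intpoly coef_poly; case: ltnP => // _.
case: ifP => // _.
have -> : 'X + (val c)%:P = intpoly ('X + c%:P).
  by rewrite /intpoly (map_polyXaddC val).
by rewrite -coef_intpoly /intpoly (map_comp_poly val).
Qed.

(** If [p] divides every exponent in [B], the reduction of the subexpansion of
    [F] is a polynomial in [(X - cv)^p] and has zero derivative, but it is the
    minimal polynomial of [theta].  If that polynomial has zero derivative, its
    coefficient at an exponent prime to [p] is zero; such an exponent could be
    removed from [B] without changing the reduction, against minimality. *)
Lemma separable_exponents (Q F : {poly K}) (B : set nat) p :
  p \in [pchar (resfield (valbase v))] ->
  minimal_exponents iota nu nubar Q F B ->
  separable_element 1 theta <-> ~ (forall l, B l -> (p %| l)%N).
Proof.
move=> pch [/max_in_Psi1_XsubC[c ->] keyF Bpos keyB minB].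
have n1 := key_poly_Psi1_deg keyF.
have [Fm szF nuF] := (key_poly_Psi1E F n1).1 keyF.
have [P EP Pm] := monic_integral Fm szF (ltW nuF).
have szP : size P = n.+1 by rewrite -size_intpoly -EP.
pose S := P \Po ('X + c%:P).
have szT B' : (size (truncation S B') <= n.+1)%N by apply: size_poly.
have keyE B' : key_poly_Psi1 (subexpansion ('X - (val c)%:P) F B') <->
    (truncation S B')`_n = 1 /\
    reduction (truncation S B') \Po ('X - (res v (vincl v c) : resext v)%:P)
      = minPoly 1 theta.
  by rewrite EP subexpansion_truncation // key_poly_Psi1_shift.
have [Tn rT] := (keyE B).1 keyB.
set cbar : resext v := res v (vincl v c) in keyE rT.
have natE l : ((l%:R : resext v) == 0) = (p %| l)%N.
  have pch' : p \in [pchar (resext v)] by apply: (rmorph_pchar (@resincl _ _ _ v)).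
  by rewrite (dvdn_pcharf pch').
have coefT B' l : (reduction (truncation S B'))`_l =
    if (l < n.+1)%N && ((l == 0) || (l \in B')) then res v (vincl v S`_l) else 0.
  rewrite coef_map /= coef_poly; case: (l < n.+1)%N => /=; last by rewrite !rmorph0.
  by case: ifP => // _; rewrite !rmorph0.
have derE : ((minPoly 1 theta)^`() == 0) =
    ((reduction (truncation S B))^`() == 0).
  rewrite -rT deriv_comp derivXsubC mulr1.
  by rewrite comp_poly2_eq0 ?size_XsubC.
rewrite separable_nz_der derE; split=> [nz pB|npB].
  move: nz; apply/negP/negPn/eqP/polyP => l; rewrite coef0 coef_deriv coefT.
  case: ifP => [/andP[_ /= lB]|_]; last by rewrite mul0rn.
  have := pB l.+1; rewrite -in_setE => /(_ lB); rewrite -natE => /eqP l0.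
  by rewrite -mulr_natr l0 mulr0.
apply/negP => /eqP der0; apply: npB => l Bl; rewrite -natE.
apply: contrapT => /negP l0.
have lpos := Bpos l Bl.
have lB : l \in B by rewrite in_setE.
(* An exponent [l] prime to [p] has zero coefficient in the reduction. *)
have rl : (l < n.+1)%N -> res v (vincl v S`_l) = 0.
  move=> ln; have := congr1 (fun q : {poly resext v} => q`_l.-1) der0.
  rewrite /= coef0 coef_deriv prednK // coefT ln lB orbT /= -mulr_natr => /eqP.
  by rewrite mulf_eq0 (negPf l0) orbF => /eqP.
(* So the subexpansion without [l] would satisfy the criterion as well. *)
apply: (minB l Bl); apply/keyE; split.
  rewrite -Tn !coef_poly ltnSn; case: (n =P 0%N) => //= _.
  have nB : n \in B.
    move: Tn; rewrite coef_poly ltnSn gtn_eqF ?(ltnW n1) //=.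
    by case: (n \in B) => // /eqP; rewrite eq_sym oner_eq0.
  rewrite nB; case: ifP => // /negP; case; rewrite in_setE.
  split; first by rewrite -in_setE.
  (* The leading exponent [n] is not [l]: its coefficient is [1]. *)
  move=> /= nl; have := rl; rewrite -nl => /(_ (ltnSn n)).
  move: Tn; rewrite coef_poly ltnSn nB orbT => ->.
  by rewrite !rmorph1 => /eqP; rewrite oner_eq0.
rewrite -rT; congr (_ \Po _); apply/polyP => i; rewrite !coefT.
have [in_|//] := ltnP i n.+1; rewrite /=; case: (i =P 0%N) => //= _.
have [il|il] := eqVneq i l.
  by rewrite il lB rl -?il //; case: ifP.
congr (if _ then _ else _); apply/idP/idP; rewrite !in_setE.
  by case.
by move=> Bi; split=> //= /eqP; rewrite (negPf il).
Qed.

End KeyPolynomials.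

End PurelyInertial.

Theorem corollary6p5 (K : fieldType) (L : fieldExtType K)
    (G : orderedAbGroupType) (v : valuation L G) (eta : valring v) (p : nat)
    (Kbar : closedFieldType) (iota : {rmorphism K -> Kbar})
    (G' : orderedAbGroupType) (j : {additive G -> G'})
    (nubar : valuation {poly Kbar} G') :
  let nu : valuation {poly K} G := valcomp (horner_alg (val eta)) v in
  purely_inertial v ->
  <<1; (res v eta : resext v)>>%VS = {:resext v}%VS ->
  p \in [pchar (resfield (valbase v))] ->
  is_alg_closure iota ->
  {mono j : x y / x <= y} ->
  (forall f : {poly K}, nubar (map_poly iota f) = omap j (nu f)) ->
  ((forall w : kahler (vincl v), w = 0) <->
     separable 1%VS {:resext v}%VS) /\
  (forall (Q F : {poly K}) (B : set nat),
     minimal_exponents iota nu nubar Q F B ->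
     (separable 1%VS {:resext v}%VS <->
        ~ (forall l : nat, B l -> (p %| l)%N))).
Proof.
move=> nu [_ _ dim_eq] gen pch _ j_mono nubarE; split.
  split=> [w0|]; last exact: separable_kahler0 gen dim_eq.
  by rewrite (separableE gen); apply: kahler0_separable w0.
move=> Q F B minB; rewrite (separableE gen).
exact: (separable_exponents gen dim_eq j_mono nubarE pch minB).
Qed.
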